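(* Let $n>2$, let $1<p<\frac{n}{n-1}$ and let $f,u_0\in L^1_{\mathrm{loc}}(\mathbb{R}^n)$ with $u_0\ge 0$. Let $X=(X_1,\dots,X_m)$ be real $C^\infty$ vector fields on $\mathbb{R}^n$, $X_k=\sum_{i=1}^n a_{k,i}\frac{\partial}{\partial x_i}$. If $\int_{\mathbb{R}^n}f(x)\,dx>0$ and the functions $a_{k,i}$ and $\frac{\partial a_{k,j}}{\partial x_i}$ are bounded on $\mathbb{R}^n$ for every $1\le k\le m$ and $1\le i,j\le n$, then the problem $u_t-\Delta_X u=|u|^p+f(x)$ in $(0,\infty)\times\mathbb{R}^n$, $u(0,x)=u_0(x)$, does not admit a global in time weak solution.
   Context: For $X_k=\sum_{i=1}^n a_{k,i}\frac{\partial}{\partial x_i}$ put $\operatorname{div}X_k=\sum_{i}\frac{\partial a_{k,i}}{\partial x_i}$, $X_k^\ast=-X_k-\operatorname{div}X_k$ and $\Delta_X=-\sum_{k=1}^m X_k^\ast X_k=\sum_{k=1}^m\bigl(X_k^2+(\operatorname{div}X_k)X_k\bigr)$. Weak solution: for $f,u_0\in L^1_{\mathrm{loc}}(\mathbb{R}^n)$, a function $u\in L^p_{\mathrm{loc}}((0,T),L^p_{\mathrm{loc}}(\mathbb{R}^n))$ is a local in time weak solution (on $[0,T)$) of $u_t-\Delta_X u=|u|^p+f(x)$, $u(0,x)=u_0(x)$, if for every non-negative test function $\psi\in C^1_c([0,T);C^2_c(\mathbb{R}^n))$ one has $\int_0^T\!\int_{\mathbb{R}^n}|u|^p\psi+\int_{\mathbb{R}^n}u_0\psi(0,x)+\int_0^T\!\int_{\mathbb{R}^n}f\psi+\int_0^T\!\int_{\mathbb{R}^n}u\psi_t+\int_0^T\!\int_{\mathbb{R}^n}u\,\Delta_X\psi=0$.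 When $T=\infty$, such $u$ is called a global in time weak solution. *)

(* Defs.v *)
From HB Require Import structures.
From mathcomp Require Import all_boot all_order all_algebra.
From mathcomp Require Import all_classical all_reals all_analysis measurable_realfun.

Set Implicit Arguments.
Unset Strict Implicit.
Unset Printing Implicit Defensive.

Import Order.TTheory GRing.Theory Num.Theory.
Import numFieldNormedType.Exports.

Local Open Scope classical_set_scope.
Local Open Scope ring_scope.

Section borel_rV.
Context {R : realType} {n : nat}.
Let opens : set (set 'rV[R]_n) := open.

HB.instance Definition _ := @isMeasurable.Build (sigma_display opens)
  'rV[R]_n <<s opens >> (@sigma_algebra0 _ setT opens)
  (fun A mA => eq_ind _ _ (@sigma_algebraCD _ setT opens A mA) _ (setTD A))
  (@sigma_algebra_bigcup _ setT opens).

End borel_rV.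

Section borel_rV_theory.
Context {R : realType}.

Lemma open_measurable_rV n (U : set 'rV[R]_n) : open U -> measurable U.
Proof. exact: sub_sigma_algebra. Qed.

Lemma continuous_measurable_rV n (g : 'rV[R]_n -> R) :
  continuous g -> measurable_fun setT (g : _ -> measurableTypeR R).
Proof.
move=> cg; apply: (measurability _ (RGenOpens.measurableE R)).
move=> _ [_ [a [b ->] <-]]; rewrite setTI; apply: open_measurable_rV.
by apply: open_comp => [x _|]; [exact: cg|exact: interval_open].
Qed.

Lemma measurable_rV_coord n i :
  measurable_fun setT (fun x : 'rV[R]_n => (x ord0 i : measurableTypeR R)).
Proof. by apply: continuous_measurable_rV; exact: coord_continuous. Qed.

Lemma measurable_rV d (T : measurableType d) n (h : T -> 'rV[R]_n) :
  (forall i, measurable_fun setT (fun t => (h t ord0 i : measurableTypeR R))) ->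
  measurable_fun setT h.
Proof.
move=> mh; apply: (@measurability _ _ T _ setT h (@open _) erefl).
move=> _ [U oU <-]; rewrite setTI.
pose B (qk : 'rV[rat]_n * nat) : set 'rV[R]_n :=
  ball (map_mx (ratr : rat -> R) qk.1 : 'rV[R]_n) (qk.2.+1%:R^-1).
have -> : U = \bigcup_(qk in [set qk | B qk `<=` U]) B qk.
  apply/seteqP; split => [x Ux|x [qk /= +]]; last exact.
  move: (oU); rewrite openE => /(_ _ Ux); rewrite /interior.
  move=> /nbhs_ballP[e /= e0 eU].
  have [k _ /(_ k (leqnn _))/= ke] :=
    near_infty_natSinv_lt (PosNum (divr_gt0 e0 (ltr0Sn R 1))).
  have k0 : 0 < k.+1%:R^-1 :> R by rewrite invr_gt0 ltr0n.
  have q_ i : exists q : rat, `|x ord0 i - ratr q| < k.+1%:R^-1.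
    have : x ord0 i < x ord0 i + k.+1%:R^-1 by rewrite ltrDl.
    move=> /rat_in_itvoo[q]; rewrite in_itv/= => /andP[xq qx]; exists q.
    by rewrite distrC ger0_norm ?subr_ge0 ?ltrBlDl// ltW.
  have [q qP] := choice q_.
  have xq : ball (map_mx (ratr : rat -> R) (\row_i q i) : 'rV[R]_n) k.+1%:R^-1 x.
    split; first by [].
    move=> i j; rewrite (ord1 i) !mxE /ball/= distrC; exact: qP.
  exists (\row_i q i, k) => //= y By; apply: eU.
  apply: le_ball (ball_triangle (ball_sym xq) By) => /=.
  by rewrite (le_trans (lerD (ltW ke) (ltW ke)))// -splitr.
rewrite preimage_bigcup bigcup_mkcond; apply: countable_bigcupT_measurable => //.
move=> qk; case: ifPn => // _.
have -> : h @^-1` B qk = \bigcap_(j in [set: 'I_n])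
    (fun t => h t ord0 j) @^-1` ball (ratr (qk.1 ord0 j) : R) (qk.2.+1%:R^-1).
  apply/seteqP; split => [t [_ /= Bt] j _|t Bt].
    by have := Bt ord0 j; rewrite mxE.
  split=> [|i j]; first by rewrite invr_gt0 ltr0n.
  by rewrite (ord1 i) mxE; exact: Bt.
apply: fin_bigcap_measurable => [|j _]; first exact: finite_finset.
rewrite -[X in measurable X]setTI.
by apply: mh => //; exact: measurable_ball.
Qed.

End borel_rV_theory.

Section lebesgue_rV_succ.
Context {R : realType} {n : nat}.
Variable mu : {sigma_finite_measure set 'rV[R]_n -> \bar R}.

Definition rV_cons (z : measurableTypeR R * 'rV[R]_n) : 'rV[R]_n.+1 :=
  row_mx (const_mx z.1 : 'rV_1) z.2.

Definition rV_uncons (x : 'rV[R]_n.+1) : measurableTypeR R * 'rV[R]_n :=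
  (x ord0 ord0, @rsubmx _ 1 1 n x).

Lemma rV_consK : cancel rV_cons rV_uncons.
Proof.
move=> [t y]; rewrite /rV_uncons /rV_cons row_mxKr; congr (_, _).
have -> : @ord0 n = lshift n (@ord0 0) by apply: val_inj.
by rewrite (@row_mxEl _ 1 1 n) mxE.
Qed.

Lemma rV_unconsK : cancel rV_uncons rV_cons.
Proof.
move=> x; rewrite /rV_uncons /rV_cons/= -[RHS](@hsubmxK _ 1 1 n).
congr (@row_mx _ 1 1 n _ _); apply/matrixP => i j; rewrite !mxE (ord1 i) (ord1 j).
by congr (x _ _); apply: val_inj.
Qed.

Lemma measurable_rV_cons : measurable_fun setT rV_cons.
Proof.
apply: measurable_rV => i; rewrite /rV_cons.
case: (@split_ordP 1 n i) => j ->.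
- rewrite (_ : (fun _ => _) = fst); first exact: measurable_fst.
  by apply/funext => z; rewrite (@row_mxEl _ 1 1 n) mxE.
- rewrite (_ : (fun _ => _) = fun z : measurableTypeR R * 'rV[R]_n => z.2 ord0 j); last first.
    by apply/funext => z; rewrite (@row_mxEr _ 1 1 n).
  exact: (measurableT_comp (measurable_rV_coord j) measurable_snd).
Qed.

Lemma measurable_rV_uncons : measurable_fun setT rV_uncons.
Proof.
apply: measurable_fun_pair; first exact: measurable_rV_coord.
apply: measurable_rV => i.
rewrite (_ : (fun _ => _) = fun x : 'rV[R]_n.+1 => x ord0 (@rshift 1 n i)).
  exact: measurable_rV_coord.
by apply/funext => x; rewrite /= mxE.
Qed.

Definition lebesgue_rV_succ : set 'rV[R]_n.+1 -> \bar R :=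
  pushforward (@lebesgue_measure R \x mu)%E rV_cons.

Let succ0 : lebesgue_rV_succ set0 = 0%E.
Proof. by rewrite /lebesgue_rV_succ /pushforward preimage_set0 measure0. Qed.

Let succ_ge0 A : (0 <= lebesgue_rV_succ A)%E.
Proof. by rewrite /lebesgue_rV_succ /pushforward measure_ge0. Qed.

Let succ_sigma_additive : semi_sigma_additive lebesgue_rV_succ.
Proof.
pose m := measure_function_pushforward__canonical__measure_function_Measure
  (@lebesgue_measure R \x mu)%E measurable_rV_cons.
exact: (@measure_semi_sigma_additive _ _ _ m).
Qed.

HB.instance Definition _ := isMeasure.Build _ _ _ lebesgue_rV_succ
  succ0 succ_ge0 succ_sigma_additive.

Let succ_sigma_finite : sigma_finite setT lebesgue_rV_succ.
Proof.
have /sigma_finiteP[F [FT ndF Foo]] := sigma_finiteT (@lebesgue_measure R).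
have /sigma_finiteP[G [GT ndG Goo]] := sigma_finiteT mu.
exists (fun k => rV_uncons @^-1` (F k `*` G k)).
  apply/esym; rewrite -preimage_bigcup -subTset => x _ /=.
  have : [set: R] (rV_uncons x).1 by [].
  rewrite FT => -[k _ Fk]; have : [set: 'rV[R]_n] (rV_uncons x).2 by [].
  rewrite GT => -[l _ Gl]; exists (maxn k l) => //; split.
    by move: Fk; exact/subsetPset/ndF/leq_maxl.
  by move: Gl; exact/subsetPset/ndG/leq_maxr.
move=> k; have [mF Fk] := Foo k; have [mG Gk] := Goo k.
split.
  rewrite -[X in measurable X]setTI; apply: measurable_rV_uncons => //.
  exact: measurableX.
rewrite /lebesgue_rV_succ /pushforward -comp_preimage.
rewrite (_ : rV_uncons \o rV_cons = id); last first.
  by apply/funext => z; exact: rV_consK.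
by rewrite preimage_id product_measure1E// lte_mul_pinfty// ge0_fin_numE.
Qed.

HB.instance Definition _ := Measure_isSigmaFinite.Build _ _ _ lebesgue_rV_succ
  succ_sigma_finite.

End lebesgue_rV_succ.

Section lebesgue_rV.
Context {R : realType}.

Fixpoint lebesgue_rV (n : nat) : {sigma_finite_measure set 'rV[R]_n -> \bar R} :=
  match n with
  | 0 => \d_ (0 : 'rV[R]_0)
  | n'.+1 => lebesgue_rV_succ (lebesgue_rV n')
  end.

Lemma lebesgue_rV_box n (A : 'I_n -> set (measurableTypeR R)) :
  (forall i, measurable (A i)) ->
  (lebesgue_rV n [set x | forall i, A i (x ord0 i)] =
   \prod_(i < n) lebesgue_measure (A i))%E.
Proof.
elim: n A => [|n IHn] A mA.
  by rewrite big_ord0 /= diracE mem_set// => -[].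
pose B : set 'rV[R]_n := [set x | forall i, A (lift ord0 i) (x ord0 i)].
have mB : measurable B.
  have -> : B = \bigcap_(i in [set: 'I_n])
      (fun x : 'rV[R]_n => x ord0 i) @^-1` A (lift ord0 i).
    by apply/seteqP; split => [x Ax i _|x Ax i]; exact: Ax.
  apply: fin_bigcap_measurable => [|i _]; first exact: finite_finset.
  rewrite -[X in measurable X]setTI.
  exact: (measurable_rV_coord i measurableT (mA _)).
rewrite big_ord_recl -(IHn (fun i => A (lift ord0 i)))// -/B.
rewrite -product_measure1E//= /lebesgue_rV_succ /pushforward; congr (_ _).
have rV_cons0 (z : measurableTypeR R * 'rV[R]_n) : rV_cons z ord0 ord0 = z.1 :> R.
  by rewrite -[LHS]/((rV_uncons (rV_cons z)).1) rV_consK.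
have rV_consS (z : measurableTypeR R * 'rV[R]_n) i : rV_cons z ord0 (lift ord0 i) = z.2 ord0 i.
  have -> : lift ord0 i = @rshift 1 n i by exact: val_inj.
  by rewrite /rV_cons (@row_mxEr _ 1 1 n).
apply/seteqP; split => [[t y]/= h|[t y]/= [h0 h] i].
  split => [|i]; first by have := h ord0; rewrite rV_cons0.
  by have := h (lift ord0 i); rewrite rV_consS.
by have [j|] := unliftP ord0 i => ->; rewrite ?rV_consS ?rV_cons0//; exact: h.
Qed.

End lebesgue_rV.

Section vector_fields.
Context {R : realType} {n : nat}.
Implicit Types (g : 'rV[R]_n -> R) (b : 'I_n -> 'rV[R]_n -> R).

Definition partial (i : 'I_n) g : 'rV[R]_n -> R := 'D_(delta_mx ord0 i) g.

Fixpoint Ck (k : nat) g : Prop :=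
  continuous g /\
  if k is k'.+1 then
    forall i, (forall x, derivable g x (delta_mx ord0 i)) /\ Ck k' (partial i g)
  else True.

Definition smooth g := forall k, Ck k g.

(* a vector field is given by its coefficients [b] in the standard basis *)
Definition vf_apply b g (x : 'rV[R]_n) : R := \sum_(i < n) b i x * partial i g x.

Definition vf_div b (x : 'rV[R]_n) : R := \sum_(i < n) partial i (b i) x.

Definition vf_adj b g (x : 'rV[R]_n) : R := - vf_apply b g x - vf_div b x * g x.

Definition vf_laplacian (m : nat) (a : 'I_m -> 'I_n -> 'rV[R]_n -> R) g
    (x : 'rV[R]_n) : R :=
  - \sum_(k < m) vf_adj (a k) (vf_apply (a k) g) x.

End vector_fields.

Section weak_solutions.
Context {R : realType} {n : nat}.
Implicit Types (T : \bar R) (f : 'rV[R]_n -> R) (u psi : R -> 'rV[R]_n -> R).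

Definition spacetime_measure :
    {measure set (measurableTypeR R * 'rV[R]_n) -> \bar R} :=
  (@lebesgue_measure R \x lebesgue_rV n)%E.

Definition open_time T : set R := [set t | 0 < t /\ (t%:E < T)%E].

Definition half_open_time T : set R := [set t | 0 <= t /\ (t%:E < T)%E].

Definition cylinder T : set (measurableTypeR R * 'rV[R]_n) :=
  open_time T `*` setT.

Definition L1_loc f : Prop :=
  measurable_fun setT (f : _ -> measurableTypeR R) /\
  forall K, compact K -> (\int[lebesgue_rV n]_(x in K) `|f x|%:E < +oo)%E.

Definition Lp_loc (p : R) T u : Prop :=
  measurable_fun (cylinder T)
    (fun z : measurableTypeR R * 'rV[R]_n => (u z.1 z.2 : measurableTypeR R)) /\
  forall (J : set R) (K : set 'rV[R]_n),
    compact J -> J `<=` open_time T -> compact K ->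
    (\int[spacetime_measure]_(z in J `*` K) (`|u z.1 z.2| `^ p)%:E < +oo)%E.

Definition C2_close (e : R) (g h : 'rV[R]_n -> R) : Prop :=
  forall x, [/\ `|g x - h x| <= e,
    forall i, `|partial i g x - partial i h x| <= e &
    forall i j, `|partial i (partial j g) x - partial i (partial j h) x| <= e].

Definition C2_cvg (F : set_system R) (g : R -> 'rV[R]_n -> R)
    (h : 'rV[R]_n -> R) : Prop :=
  forall e : R, 0 < e -> \forall s \near F, C2_close e (g s) h.

(* C^1_c([0,T); C^2_c(R^n)): [dpsi] is the time derivative of [psi], one-sided
   at 0.  A compactly supported continuous map into C^2_c(R^n) takes its values
   in C^2_K for one compact K, and there the topology is that of the C^2 norm. *)
Definition test_function T psi : Prop :=
  (exists (tau : R) (K : set 'rV[R]_n), [/\ (tau%:E < T)%E, compact K &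
    forall t x, half_open_time T t -> psi t x != 0 -> t <= tau /\ K x]) /\
  exists dpsi : R -> 'rV[R]_n -> R, forall t, half_open_time T t ->
    [/\ Ck 2 (psi t), Ck 2 (dpsi t),
      C2_cvg (within (half_open_time T) (dnbhs t))
        (fun s x => (psi s x - psi t x) / (s - t)) (dpsi t) &
      C2_cvg (within (half_open_time T) (nbhs t)) dpsi (dpsi t)].

(* In \bar R one has -oo + +oo = -oo, so the identity below forces each of its
   five integrals to be finite, that is, each integrand to be integrable. *)
Definition weak_solution (m : nat) (a : 'I_m -> 'I_n -> 'rV[R]_n -> R) (p : R)
    f (u0 : 'rV[R]_n -> R) T u : Prop :=
  Lp_loc p T u /\
  forall psi, test_function T psi ->
    (forall t x, half_open_time T t -> 0 <= psi t x) ->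
    (\int[spacetime_measure]_(z in cylinder T)
        (`|u z.1 z.2| `^ p * psi z.1 z.2)%:E
     + \int[lebesgue_rV n]_x (u0 x * psi 0%R x)%:E
     + \int[spacetime_measure]_(z in cylinder T) (f z.2 * psi z.1 z.2)%:E
     + \int[spacetime_measure]_(z in cylinder T)
        (u z.1 z.2 * derive1 (psi ^~ z.2) z.1)%:E
     + \int[spacetime_measure]_(z in cylinder T)
        (u z.1 z.2 * vf_laplacian a (psi z.1) z.2)%:E = 0)%E.

Definition global_weak_solution (m : nat) (a : 'I_m -> 'I_n -> 'rV[R]_n -> R)
    (p : R) f (u0 : 'rV[R]_n -> R) u : Prop :=
  weak_solution a p f u0 +oo%E u.

End weak_solutions.

(* Main.v *)
(* Test the equation against psi(t, x) = (1 - t/N)_+^l (1 - |x|^2/N^2)_+^l with l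
   large. With y the product of the two bases, which lies in [0, 1], boundedness
   of the coefficients and of their first derivatives gives
   |psi_t| + |Delta_X psi| <= (C / N) y^(l-2), and Young's inequality turns
   |u| (C / N) y^(l-2) into at most |u|^p y^l + (C / N)^q with q = p / (p - 1).
   The term in |u|^p psi cancels exactly, so that int int f psi is at most
   (C / N)^q times the volume of the support, i.e. O(N^(n + 1 - q)). It is also
   bounded below by a multiple of N, because int f > 0 and psi increases to 1.
   This is absurd for large N, since p < n / (n - 1) means q > n. *)
Require Import Defs.
From HB Require Import structures.
From mathcomp Require Import all_boot all_order all_algebra.
From mathcomp Require Import all_classical all_reals all_analysis measurable_realfun.
From mathcomp Require Import ring lra.
Import Order.TTheory GRing.Theory Num.Theory.
Import numFieldNormedType.Exports.
Local Open Scope classical_set_scope.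
Local Open Scope ring_scope.

(** * Truncated powers and the cutoff function *)

Section continuous_real.
Context {R : realType} {T : topologicalType}.
Implicit Types f g : T -> R.

Lemma continuous_const (c : R) : continuous (fun _ : T => c).
Proof. exact: cst_continuous. Qed.

Lemma continuous_add f g : continuous f -> continuous g -> continuous (fun x => f x + g x).
Proof. by move=> cf cg x; exact: (cvgD (cf x) (cg x)). Qed.

Lemma continuous_sub f g : continuous f -> continuous g -> continuous (fun x => f x - g x).
Proof. by move=> cf cg x; exact: (cvgB (cf x) (cg x)). Qed.

Lemma continuous_opp f : continuous f -> continuous (fun x => - f x).
Proof. by move=> cf x; exact: (cvgN (cf x)). Qed.

Lemma continuous_mul f g : continuous f -> continuous g -> continuous (fun x => f x * g x).
Proof. by move=> cf cg x; exact: (cvgM (cf x) (cg x)). Qed.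

Lemma continuous_scale c f : continuous f -> continuous (fun x => c * f x).
Proof. by move=> cf; apply: continuous_mul => //; exact: continuous_const. Qed.

Lemma continuous_sum (I : Type) (r : seq I) (F : I -> T -> R) :
  (forall i, continuous (F i)) -> continuous (fun x => \sum_(i <- r) F i x).
Proof.
by move=> cF; apply: (continuous_big (op := +%R)) => // ; exact: add_continuous.
Qed.

End continuous_real.

(* Junk value: [pospow 0] is the constant [1], since [0 ^+ 0 = 1]. *)
Definition pospow {R : realType} (k : nat) (s : R) : R := Num.max 0 s ^+ k.

Section pospow.
Context {R : realType}.
Implicit Types (s t : R) (k : nat).

Lemma pos_ge0 s : 0 <= Num.max 0 s :> R. Proof. by rewrite le_max lexx. Qed.

Lemma pospow_ge0 k s : 0 <= pospow k s.
Proof. by rewrite exprn_ge0// pos_ge0. Qed.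

Lemma pospow_le1 k s : s <= 1 -> pospow k s <= 1.
Proof. by move=> s1; rewrite exprn_ile1 ?pos_ge0// ge_max ler01. Qed.

Lemma le_pospow k s t : s <= t -> pospow k s <= pospow k t.
Proof.
move=> st; apply: lerXn2r; rewrite ?nnegrE ?pos_ge0//.
by rewrite ge_max !le_max lexx st orbT.
Qed.

Lemma pospow_le k l s : (l <= k)%N -> s <= 1 -> pospow k s <= pospow l s.
Proof. by move=> lk s1; rewrite ler_wiXn2l ?pos_ge0// ge_max ler01. Qed.

(** The junk value at exponent [0] forces [0 < k]: for [s < 0] the left side would be [0] and the
    right side [s]. *)
Lemma pospowS k s : (0 < k)%N -> pospow k.+1 s = s * pospow k s.
Proof.
rewrite /pospow; case: k => // k _; rewrite maxEle; case: ifPn => [s0|].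
  by rewrite exprS.
by rewrite !expr0n mulr0.
Qed.

(** A quadratic Taylor remainder for the squared positive part. It yields the derivative at every
    point at once, the kink at [0] included. *)
Lemma pospow_quadratic s t : `|pospow 2 s - pospow 2 t - 2 * Num.max 0 t * (s - t)| <= (s - t) ^+ 2.
Proof.
rewrite /pospow ler_norml !maxEle.
have := sqr_ge0 (s - t); have := sqr_ge0 s; have := sqr_ge0 t.
case: (leP 0 s) => s0; case: (leP 0 t) => t0 ? ? ?; apply/andP.
- by split; lra.
- have : 0 <= s * - t by rewrite mulr_ge0// oppr_ge0 ltW.
  by split; lra.
- have : 0 <= t * - s by rewrite mulr_ge0// oppr_ge0 ltW.
  by split; lra.
- by split; lra.
Qed.

Lemma continuous_pospow k : continuous (@pospow R k).
Proof.
move=> s; apply: (@continuous_comp _ _ _ (fun s => Num.max 0 s) (fun x => x ^+ k)).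
  by apply: continuous_max; [exact: cvg_cst|exact: cvg_id].
exact: exprn_continuous.
Qed.

(** Induction on the exponent, with the product rule applied to [s * pospow k.+2 s]. It starts at
    exponent [2], where the quadratic remainder gives the derivative; exponent [1] has a corner at
    [0]. *)
Lemma is_derive_pospow k t :
  is_derive t 1 (@pospow R k.+2) (k.+2%:R * pospow k.+1 t).
Proof.
elim: k t => [|k IH] t; last first.
  rewrite (_ : pospow _ = (id : R -> R) * pospow k.+2); last first.
    by apply/funext => s; rewrite pospowS.
  apply: is_derive_eq.
  rewrite -[_ *: _]/(_ * _) -[_ *: _]/(_ * _).
  by rewrite /= !mulr1 (@pospowS k.+1)// -[k.+3%:R]natr1; ring.
have lim : (fun h : R => h^-1 *: ((pospow 2 \o shift t) (h *: 1) - pospow 2 t)) @ 0^' -->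
    2 * Num.max 0 t.
  apply/cvgrPdist_le => e e0; near=> h.
  have h0 : h != 0 by near: h; exact: nbhs_dnbhs_neq.
  have he : `|h| <= e.
    by near: h; exact: dnbhs0_le.
  rewrite /= [h *: 1]mulr1 -(ler_pM2l (_ : 0 < `|h|)) ?normr_gt0//.
  rewrite -normrM.
  rewrite (_ : h * _ = - (pospow 2 (h + t) - pospow 2 t - 2 * Num.max 0 t * (h + t - t))); last first.
    by rewrite -[_ *: _]/(_ * _); field.
  rewrite normrN (le_trans (pospow_quadratic _ _))// addrK.
  by rewrite -normr_id -real_normK ?num_real// normr_id expr2 ler_wpM2l.
split; first by apply/cvg_ex; eexists; exact: lim.
by rewrite /derive; rewrite (cvg_lim _ lim)// /pospow expr1.
Unshelve. all: by end_near. Qed.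

End pospow.

(** * Directional derivatives: chain rule and coordinates *)

Section calculus.
Context {R : realType}.

(** Only the derivative of [q] in the direction [v] is given, so [q] is restricted to the line
    [s *: v + x], where the one-dimensional chain rule applies. *)
Lemma is_derive_comp_real (V : normedModType R) (g : R -> R) (q : V -> R)
    (x v : V) (dg dq : R) :
  is_derive x v q dq -> is_derive (q x) 1 g dg ->
  is_derive x v (g \o q) (dg * dq).
Proof.
move=> [dqx qE] [dgx gE].
have line (h : V -> R) : 'D_v h x = derive1 (fun s : R => h (s *: v + x)) 0.
  rewrite derive1E /derive; set F := fun s => _; set G := fun s => _.
  suff -> : F = G by [].
  by apply/funext => s; rewrite /F /G /= addr0 scale0r add0r [_%:A]mulr1.
have comp (F : R -> R) : derivable F 0 1 -> F 0 = q x ->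
    derivable (g \o F) 0 1 /\ derive1 (g \o F) 0 = dg * derive1 F 0.
  move=> dF F0; rewrite -F0 in dgx gE.
  split; last by rewrite (derive1_comp dF dgx) [derive1 g _]derive1E gE.
  exact: (proj2 (derivable1_diffP _ _) (differentiable_comp
    (proj1 (derivable1_diffP _ _) dF) (proj1 (derivable1_diffP _ _) dgx))).
have [||dgq gqE] := comp (fun s => q (s *: v + x)).
- exact: (proj1 (derivable1P q x v) dqx).
- by rewrite scale0r add0r.
split; first exact: (proj2 (derivable1P (g \o q) x v) dgq).
by rewrite line; apply: (eq_trans gqE); rewrite -line qE.
Qed.

Lemma is_derive_coord n (x v : 'rV[R]_n) (i : 'I_n) :
  is_derive x v (fun y : 'rV[R]_n => y ord0 i) (v ord0 i).
Proof.
have quot (h : R) : h != 0 ->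
    h^-1 *: (((fun y : 'rV[R]_n => y ord0 i) \o shift x) (h *: v) - x ord0 i) = v ord0 i.
  by move=> h0; rewrite /= !mxE addrK -[_ *: _]/(_ * _) mulKf.
have lim : (fun h : R => h^-1 *: (((fun y : 'rV[R]_n => y ord0 i) \o shift x) (h *: v) - x ord0 i)) @ 0^' -->
    v ord0 i.
  apply: cvg_near_cst; near=> h; apply: quot; near: h; exact: nbhs_dnbhs_neq.
split; first by apply/cvg_ex; eexists; exact: lim.
by rewrite /derive (cvg_lim _ lim).
Unshelve. all: by end_near. Qed.

End calculus.

(** * The spatial bump and its derivatives *)

Section bump.
Context {R : realType} {n : nat}.
Variables (rho : R) (k : nat).
Implicit Types (x : 'rV[R]_n) (i j : 'I_n).

Definition parab x : R := 1 - rho ^+ 2 * \sum_i x ord0 i ^+ 2.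

(** A bump on the ball of radius [1 / rho]. Two derivatives lower the exponent to [k.+1], which is
    still positive, so the second derivatives stay continuous across the sphere. *)
Definition ball_bump x : R := pospow k.+3 (parab x).

Lemma parab_le1 x : parab x <= 1.
Proof.
by rewrite gerBl mulr_ge0 ?sqr_ge0//; apply: sumr_ge0 => i _; exact: sqr_ge0.
Qed.

Lemma is_derive_parab x i :
  is_derive x (delta_mx ord0 i) parab (- (2 * rho ^+ 2 * x ord0 i)).
Proof.
rewrite (_ : parab = cst 1 - (rho ^+ 2) *: (\sum_j (fun y : 'rV[R]_n => y ord0 j) ^+ 2)); last first.
  apply/funext => y; rewrite /parab /=; congr (_ - _ * _).
  by rewrite fct_sumE.
have ? j := is_derive_coord n x (delta_mx ord0 i) j.
apply: is_derive_eq.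
rewrite sub0r (bigD1 i)//= big1 => [|j ji]; last first.
  by rewrite mxE eqxx (negbTE ji) scaler0.
rewrite mxE !eqxx addr0 expr1; congr (- _).
by rewrite -![_ *: _]/(_ * _) mulr1; ring.
Qed.

Lemma continuous_parab : continuous parab.
Proof.
apply: continuous_sub; first exact: continuous_const.
apply: continuous_scale; apply: continuous_sum => i x.
apply: (@continuous_comp _ _ _ (fun x : 'rV[R]_n => x ord0 i) (fun s => s ^+ 2)).
  exact: coord_continuous.
exact: exprn_continuous.
Qed.

Lemma continuous_pospow_parab l : continuous (fun x => pospow l (parab x)).
Proof.
move=> x; apply: (@continuous_comp _ _ _ parab (pospow l)).
  exact: continuous_parab.
exact: continuous_pospow.
Qed.

Lemma continuous_bump : continuous ball_bump.
Proof. exact: continuous_pospow_parab. Qed.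

Lemma is_derive_pospow_parab l x i :
  is_derive x (delta_mx ord0 i) (fun y => pospow l.+2 (parab y))
    (l.+2%:R * pospow l.+1 (parab x) * - (2 * rho ^+ 2 * x ord0 i)).
Proof.
apply: (@is_derive_comp_real _ _ (pospow l.+2) parab).
  exact: is_derive_parab.
exact: is_derive_pospow.
Qed.

Definition dbump i x : R :=
  k.+3%:R * pospow k.+2 (parab x) * - (2 * rho ^+ 2 * x ord0 i).

Definition ddbump i j x : R :=
  k.+3%:R * (k.+2%:R * pospow k.+1 (parab x) * (4 * rho ^+ 4 * x ord0 i * x ord0 j)
   - pospow k.+2 (parab x) * (2 * rho ^+ 2 * (i == j)%:R)).

Lemma is_derive_bump x i : is_derive x (delta_mx ord0 i) ball_bump (dbump i x).
Proof. exact: is_derive_pospow_parab. Qed.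

Lemma is_derive_dbump x i j :
  is_derive x (delta_mx ord0 i) (dbump j) (ddbump i j x).
Proof.
rewrite (_ : dbump j = k.+3%:R *: ((fun y => pospow k.+2 (parab y)) *
    (- (2 * rho ^+ 2) *: (fun y : 'rV[R]_n => y ord0 j)))); last first.
  apply/funext => y; rewrite /dbump -mulrA; congr (_ * (_ * _)).
  by rewrite -[RHS]/(- (2 * rho ^+ 2) * y ord0 j) mulNr.
have ? := is_derive_coord n x (delta_mx ord0 i) j.
have ? := @is_derive_pospow_parab k x i.
apply: is_derive_eq.
rewrite mxE eqxx/= -![_ *: _]/(_ * _) /ddbump (eq_sym i).
rewrite /GRing.scale/=.
rewrite -[_ *: x ord0 j]/(- (2 * rho ^+ 2) * x ord0 j).
by ring.
Qed.

Lemma partial_bump i : partial i ball_bump = dbump i.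
Proof. by apply/funext => x; have [_ <-] := is_derive_bump x i. Qed.

Lemma partial_dbump i j : partial i (dbump j) = ddbump i j.
Proof. by apply/funext => x; have [_ <-] := is_derive_dbump x i j. Qed.

Lemma continuous_dbump i : continuous (dbump i).
Proof.
apply: continuous_mul.
  by apply: continuous_scale; exact: continuous_pospow_parab.
by apply: continuous_opp; apply: continuous_scale; exact: coord_continuous.
Qed.

Lemma continuous_ddbump i j : continuous (ddbump i j).
Proof.
have cpos := continuous_pospow_parab.
have cx l : continuous (fun x : 'rV[R]_n => x ord0 l).
  exact: coord_continuous.
apply: continuous_scale; apply: continuous_sub.
  apply: continuous_mul; first exact: continuous_scale.
  by apply: continuous_mul => //; exact: continuous_scale.
by apply: continuous_mul => //; exact: continuous_const.
Qed.

Lemma Ck2_bump : Ck 2 ball_bump.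
Proof.
split; first exact: continuous_bump.
move=> i; split; first by move=> x; have [] := is_derive_bump x i.
rewrite partial_bump; split; first exact: continuous_dbump.
move=> j; split; first by move=> x; have [] := is_derive_dbump x j i.
rewrite partial_dbump; split => //; exact: continuous_ddbump.
Qed.

Lemma parab_gt0_coord x i : 0 < parab x -> `|rho * x ord0 i| <= 1.
Proof.
rewrite subr_gt0 (bigD1 i)//= mulrDr => h.
rewrite -(@expr_le1 _ 2)// -normrX ger0_norm ?sqr_ge0// exprMn; apply/ltW/(le_lt_trans _ h).
rewrite lerDl mulr_ge0 ?sqr_ge0//; apply: sumr_ge0 => j _; exact: sqr_ge0.
Qed.

(** One constant for first and second derivatives: [4 * k.+2] comes from differentiating the power
    twice, [2] from differentiating the inner quadratic. *)
Definition bump_const : R := k.+3%:R * (4 * k.+2%:R + 2).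

Hypothesis rho01 : 0 <= rho <= 1.

(** Where the power is nonzero, [x] lies in the ball of radius [1 / rho]; elsewhere both sides
    vanish. This absorbs the unbounded factors [x ord0 i] in the derivatives. *)
Let rho_coord_le l x i :
  `|rho * x ord0 i| * pospow l.+1 (parab x) <= pospow l.+1 (parab x).
Proof.
have [z0|z0] := leP (parab x) 0.
  by rewrite /pospow (max_l z0) expr0n mulr0.
by rewrite ler_piMl ?pospow_ge0//; exact: parab_gt0_coord.
Qed.

Let pospow_parab_le x : pospow k.+2 (parab x) <= pospow k.+1 (parab x).
Proof. by apply: pospow_le => //; exact: parab_le1. Qed.

Lemma dbump_le i x : `|dbump i x| <= bump_const * rho * pospow k.+1 (parab x).
Proof.
have /andP[rho0 rho1] := rho01.
have := rho_coord_le k.+1 x i; have := pospow_parab_le x.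
have := pospow_ge0 k.+2 (parab x).
rewrite /dbump /bump_const.
move: (pospow k.+2 _) (pospow k.+1 _) => P Q P0 PQ cP.
(* One factor [rho] is spent on the coordinate; the other one is the decay in the bound. *)
rewrite (_ : 2 * _ * _ = 2 * rho * (rho * x ord0 i)); last ring.
rewrite !normrM normrN normrM [`|2 * rho|]ger0_norm ?mulr_ge0//.
rewrite (ger0_norm P0) ger0_norm// -!mulrA ler_pM2l ?ltr0n//.
rewrite [leLHS](_ : _ = 2 * (rho * (`|rho * x ord0 i| * P))); last ring.
rewrite ler_pM ?mulr_ge0//; first by rewrite lerDr mulr_ge0.
by rewrite ler_wpM2l// (le_trans cP).
Qed.

(** Two factors [rho] are spent on the two coordinates, and the remaining [rho ^+ 2] is at most
    [rho]. The bound is thus the same as for [dbump], so that both can be used with one constant. *)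
Lemma ddbump_le i j x : `|ddbump i j x| <= bump_const * rho * pospow k.+1 (parab x).
Proof.
have /andP[rho0 rho1] := rho01.
have rho2 : rho ^+ 2 <= rho by rewrite expr2 ler_piMl.
have := rho_coord_le k x i; have := rho_coord_le k x j.
have := pospow_parab_le x.
have := pospow_ge0 k.+2 (parab x); have := pospow_ge0 k.+1 (parab x).
rewrite /ddbump /bump_const.
move: (pospow k.+2 _) (pospow k.+1 _) => P Q Q0 P0 PQ cjQ ciQ.
rewrite normrM ger0_norm// -!mulrA ler_pM2l ?ltr0n//.
apply: (le_trans (ler_normB _ _)); rewrite [leRHS]mulrDl; apply: lerD.
  rewrite (_ : k.+2%:R * _ = 4 * k.+2%:R * (rho ^+ 2 * ((rho * x ord0 i) * ((rho * x ord0 j) * Q)))); last ring.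
  rewrite normrM ger0_norm ?mulr_ge0// ler_wpM2l ?mulr_ge0//.
  rewrite normrM ger0_norm ?sqr_ge0// ler_pM ?sqr_ge0//.
  rewrite [leLHS](_ : _ = `|rho * x ord0 i| * (`|rho * x ord0 j| * Q)); last first.
    by rewrite -[in RHS](ger0_norm Q0) -!normrM !mulrA.
  by apply: (le_trans _ ciQ); rewrite ler_wpM2l.
rewrite normrM (ger0_norm P0) ger0_norm ?mulr_ge0 ?sqr_ge0//.
rewrite [leLHS](_ : _ = 2 * (rho ^+ 2 * ((i == j)%:R * P))); last ring.
rewrite ler_wpM2l// ler_pM ?sqr_ge0 ?mulr_ge0//.
by rewrite (le_trans _ PQ)// ler_piMl// lern1 leq_b1.
Qed.

End bump.

(** * The operator of the vector fields: expansion, linearity, bounds *)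

Section vector_field_calculus.
Context {R : realType} {n : nat}.
Implicit Types (g h : 'rV[R]_n -> R) (i j : 'I_n).

Lemma partial_scale i (c : R) g : (forall x, derivable g x (delta_mx ord0 i)) ->
  partial i (fun x => c * g x) = fun x => c * partial i g x.
Proof. by move=> dg; apply/funext => x; exact: deriveZ. Qed.

Lemma Ck_scale l (c : R) g : Ck l g -> Ck l (fun x => c * g x).
Proof.
elim: l g => [|l IH] g [cg dg]; split => //; try exact: continuous_scale.
move=> i; have [dgi Cg] := dg i; split => [x|].
  exact: (@derivableZ _ _ _ g).
by rewrite partial_scale//; exact: IH.
Qed.

Lemma partial_vf_apply (b : 'I_n -> 'rV[R]_n -> R) g i :
  (forall j, smooth (b j)) -> Ck 2 g ->
  partial i (vf_apply b g) = fun x =>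
    \sum_j (partial i (b j) x * partial j g x + b j x * partial i (partial j g) x).
Proof.
move=> sb [_ dg]; apply/funext => x.
have db j : derivable (b j) x (delta_mx ord0 i).
  by have [_ /(_ i)[+ _]] := sb j 1%N; exact.
have dgj j : derivable (partial j g) x (delta_mx ord0 i).
  by have [_ [_ /(_ i)[+ _]]] := dg j; exact.
rewrite /partial (_ : vf_apply b g = \sum_j (b j * partial j g)); last first.
  by apply/funext => y; rewrite fct_sumE.
rewrite derive_sum; last by move=> j; exact: derivableM.
apply: eq_bigr => j _; rewrite deriveM// addrC -![_ *: _]/(_ * _).
by rewrite mulrC.
Qed.

Section laplacian.
Context {m : nat}.
Variable a : 'I_m -> 'I_n -> 'rV[R]_n -> R.
Hypothesis sa : forall k i, smooth (a k i).

(** The expansion of the sum of [X_k^2 + (div X_k) X_k]. The coefficients are differentiated at most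
    once, which is why bounds on them and on their first derivatives suffice. *)
Lemma vf_laplacianE g : Ck 2 g ->
  vf_laplacian a g = fun x => \sum_k (\sum_i a k i x *
    (\sum_j (partial i (a k j) x * partial j g x + a k j x * partial i (partial j g) x))
   + vf_div (a k) x * \sum_j a k j x * partial j g x).
Proof.
move=> Cg; apply/funext => x; rewrite /vf_laplacian -sumrN; apply: eq_bigr => k _.
rewrite /vf_adj opprB addrC opprK [in LHS]/vf_apply; congr (_ + _).
by apply: eq_bigr => i _; rewrite partial_vf_apply.
Qed.

Lemma vf_laplacian_scale c g : Ck 2 g ->
  vf_laplacian a (fun x => c * g x) = fun x => c * vf_laplacian a g x.
Proof.
move=> Cg; have Ccg := Ck_scale 2 c g Cg.
rewrite !vf_laplacianE//; apply/funext => x.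
have [_ dg] := Cg.
have p1 j : partial j (fun x => c * g x) = fun x => c * partial j g x.
  by rewrite partial_scale//; have [] := dg j.
rewrite mulr_sumr; apply: eq_bigr => k _; rewrite mulrDr; congr (_ + _).
  rewrite mulr_sumr; apply: eq_bigr => i _; rewrite mulrCA; congr (_ * _).
  rewrite mulr_sumr; apply: eq_bigr => j _; rewrite p1 partial_scale; last first.
    by have [_ [_ /(_ i)[]]] := dg j.
  by ring.
rewrite mulrCA; congr (_ * _); rewrite mulr_sumr; apply: eq_bigr => j _.
by rewrite p1; ring.
Qed.

Lemma continuous_vf_laplacian g : Ck 2 g -> continuous (vf_laplacian a g).
Proof.
move=> Cg; rewrite vf_laplacianE//; have [_ dg] := Cg.
have ca k i : continuous (a k i) by have [] := sa k i 0%N.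
have cpa k i j : continuous (partial i (a k j)).
  by have [_ /(_ i)[_ []]] := sa k j 1%N.
have cp i : continuous (partial i g) by have [_ []] := dg i.
have cpp i j : continuous (partial i (partial j g)).
  by have [_ [_ /(_ i)[_ []]]] := dg j.
apply: continuous_sum => k; apply: continuous_add.
  apply: continuous_sum => i; apply: continuous_mul => //.
  by apply: continuous_sum => j; apply: continuous_add; exact: continuous_mul.
apply: continuous_mul; first exact: continuous_sum.
by apply: continuous_sum => j; exact: continuous_mul.
Qed.

(** Each of the [m] fields contributes three times [n^2 A^2 D]: twice from the Leibniz rule in
    [X_k^2] and once from the divergence term. *)
Lemma vf_laplacian_le (A D : R) g x :
  0 <= A -> 0 <= D ->
  (forall k i, `|a k i x| <= A) -> (forall k i j, `|partial i (a k j) x| <= A) ->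
  Ck 2 g -> (forall i, `|partial i g x| <= D) ->
  (forall i j, `|partial i (partial j g) x| <= D) ->
  `|vf_laplacian a g x| <= m%:R * (3 * n%:R ^+ 2 * A ^+ 2) * D.
Proof.
move=> A0 D0 aA paA Cg gD ggD; rewrite vf_laplacianE//.
have sumle l (F : 'I_l -> R) (B : R) :
    (forall r : 'I_l, `|F r| <= B) -> `|\sum_r F r| <= l%:R * B.
  move=> FB; apply: (le_trans (ler_norm_sum _ _ _)).
  apply: (le_trans (ler_sum _ (fun r _ => FB r))).
  by rewrite sumr_const card_ord mulr_natl.
rewrite -mulrA; apply: (sumle m) => k.
rewrite (_ : _ * D = n%:R * (A * (n%:R * (A * D + A * D))) + n%:R * A * (n%:R * (A * D))); last ring.
apply: (le_trans (ler_normD _ _)); apply: lerD.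
  apply: (sumle n) => i; rewrite normrM; apply: ler_pM => //.
  apply: (sumle n) => j; apply: (le_trans (ler_normD _ _)).
  by apply: lerD; rewrite normrM; apply: ler_pM.
rewrite normrM; apply: ler_pM => //; first by apply: (sumle n).
by apply: (sumle n) => j; rewrite normrM; apply: ler_pM.
Qed.

End laplacian.
End vector_field_calculus.

(** * Separable test functions *)

Section separable_test_function.
Context {R : realType} {n : nat}.
Implicit Types (beta : 'rV[R]_n -> R).

Definition C2_bounded (M : R) beta := forall x : 'rV[R]_n,
  [/\ `|beta x| <= M, forall i, `|partial i beta x| <= M &
      forall i j, `|partial i (partial j beta) x| <= M].

Lemma C2_close_scale beta (M e c d : R) :
  Ck 2 beta -> C2_bounded M beta -> `|c - d| * M <= e ->
  C2_close e (fun x => c * beta x) (fun x => d * beta x).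
Proof.
move=> [_ Cb] bM cde x; have [b0 b1 b2] := bM x.
have p1 r j : partial j (fun x => r * beta x) = fun x => r * partial j beta x.
  by rewrite partial_scale//; have [] := Cb j.
have p2 r i j : partial i (partial j (fun x => r * beta x)) =
    fun x => r * partial i (partial j beta) x.
  by rewrite p1 partial_scale//; have [_ [_ /(_ i)[]]] := Cb j.
have le z : `|z| <= M -> `|c * z - d * z| <= e.
  by move=> zM; rewrite -mulrBl normrM (le_trans _ cde)// ler_wpM2l.
by split=> [|i|i j]; rewrite ?p2 ?p1; exact: le.
Qed.

(** For a product, [C2_close] reduces to closeness of the scalar factors, because [beta] has a
    bounded C^2 norm. Convergence of the difference quotients and of the derivative is then
    convergence in one real variable. *)
Lemma test_function_separable (tau M : R) (alpha dalpha : R -> R) beta K :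
  (forall t, tau < t -> alpha t = 0) ->
  (forall t : R, is_derive t 1 alpha (dalpha t)) -> continuous dalpha ->
  compact K -> (forall x, beta x != 0 -> K x) ->
  Ck 2 beta -> C2_bounded M beta ->
  test_function +oo%E (fun t x => alpha t * beta x).
Proof.
move=> atau dal cdal cK bK Cb bM; split.
  exists tau, K; split => //; first exact: ltry.
  move=> t x _; rewrite mulf_eq0 negb_or => /andP[at0 bx0]; split; last exact: bK.
  by rewrite leNgt; apply/negP => /atau/eqP; exact/negP.
have M0 : 0 <= M by have [+ _ _] := bM 0; exact: le_trans.
(* The divisor [M + 1] is positive even when [M = 0]. *)
have eM e : 0 < e -> 0 < e / (M + 1).
  by move=> e0; rewrite divr_gt0// ltr_wpDl.
have close e c d : `|c - d| <= e / (M + 1) ->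
    C2_close e (fun x => c * beta x) (fun x => d * beta x).
  move=> cd; apply: (C2_close_scale _ M) => //.
  rewrite -[leRHS](@divfK _ (M + 1)) ?gt_eqF ?ltr_wpDl//.
  by rewrite ler_pM// lerDl.
exists (fun t x => dalpha t * beta x) => t _; split.
- exact: Ck_scale.
- exact: Ck_scale.
- move=> e e0; rewrite near_withinE.
  have [dat <-] := dal t.
  move/cvg_ex : dat => [l dl].
  have -> : 'D_1 alpha t = l by exact: cvg_lim.
  move/cvgrPdist_le : dl => /(_ _ (eM _ e0)).
  move=> /nbhs_ballP[r /= r0 rP]; apply/nbhs_ballP; exists r => //= s tr st _.
  rewrite (_ : (fun x => _) = fun x => (alpha s - alpha t) / (s - t) * beta x); last first.
    by apply/funext => x; rewrite -mulrBl mulrAC.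
  apply: close; rewrite distrC.
  move: tr; rewrite /ball/= [`|t - s|]distrC => tr; have := rP (s - t).
  rewrite /ball/= sub0r normrN => /(_ tr); rewrite subr_eq0 => /(_ st).
  by rewrite [(s - t)%:A]mulr1 subrK -[_ *: _]/(_ * _) [(s - t)^-1 * _]mulrC.
- move=> e e0; rewrite near_withinE.
  move/cvgrPdist_le : (cdal t) => /(_ _ (eM _ e0)); apply: filterS => s ds _.
  by apply: close; rewrite distrC.
Qed.

End separable_test_function.

(** * The space-time cutoff as a test function *)

Section cutoff.
Context {R : realType} {n : nat}.
(* The exponent of the cutoff is [k.+3] and its scale is [N.+1], so that the
   scale is positive and the second derivatives are continuous. *)
Variables (k N : nat).

Let rho : R := N.+1%:R^-1.

Definition ramp (t : R) : R := pospow k.+3 (1 - rho * t).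

Definition dramp (t : R) : R := - (k.+3%:R * rho * pospow k.+2 (1 - rho * t)).

Definition cutoff (t : R) (x : 'rV[R]_n) : R := ramp t * ball_bump rho k x.

Lemma rho01 : 0 <= rho <= 1.
Proof. by rewrite invr_ge0 ler0n invf_le1// ler1n. Qed.

Lemma is_derive_ramp (t : R) : is_derive t 1 ramp (dramp t).
Proof.
have dl : is_derive t 1 (fun t : R => 1 - rho * t) (- rho).
  rewrite (_ : (fun t => _) = cst 1 - rho *: id) //.
  by apply: is_derive_eq; rewrite sub0r [_ *: _]mulr1.
have := is_derive_comp_real _ _ _ _ _ _ _ dl (is_derive_pospow k.+1 _).
by rewrite mulrN mulrAC.
Qed.

Lemma continuous_ramp_arg l : continuous (fun t : R => pospow l (1 - rho * t)).
Proof.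
move=> t; apply: (@continuous_comp _ _ _ (fun t : R => 1 - rho * t) (pospow l)).
  apply: continuous_sub; first exact: continuous_const.
  by apply: continuous_scale => ?; exact: cvg_id.
exact: continuous_pospow.
Qed.

Lemma continuous_dramp : continuous dramp.
Proof.
apply: continuous_opp; apply: continuous_scale; exact: continuous_ramp_arg.
Qed.

Lemma ramp_eq0 t : N.+1%:R < t -> ramp t = 0.
Proof.
move=> Nt; rewrite /ramp /pospow max_l ?expr0n//.
by rewrite subr_le0 mulrC ler_pdivlMr ?mul1r ?ltW ?ltr0n.
Qed.

(** A cube around the ball that supports the bump, preferred to the ball because its volume is a
    product of lengths. *)
Definition cube : set 'rV[R]_n :=
  [set x | forall i, x ord0 i \in `[- N.+1%:R, N.+1%:R]].

Lemma parab_gt0_cube x : 0 < parab rho x -> cube x.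
Proof.
move=> x0 i; have := parab_gt0_coord _ _ i x0.
rewrite normrM ger0_norm ?invr_ge0// mulrC ler_pdivrMr ?ltr0n// mul1r.
by rewrite ler_norml in_itv.
Qed.

Lemma compact_cube : compact cube.
Proof.
have := @rV_compact R n (fun=> [set` `[- N.+1%:R, N.+1%:R]%R]).
by apply => i; exact: segment_compact.
Qed.

Lemma bump_ge0 (x : 'rV[R]_n) : 0 <= ball_bump rho k x. Proof. exact: pospow_ge0. Qed.

Lemma bump_le1 (x : 'rV[R]_n) : ball_bump rho k x <= 1.
Proof. by apply: pospow_le1; exact: parab_le1. Qed.

(** The [1] bounds the bump itself; [bump_const k] bounds its derivatives, since [rho] and the
    truncated powers are at most [1]. *)
Lemma C2_bounded_bump : C2_bounded (bump_const k + 1) (ball_bump rho k : 'rV[R]_n -> R).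
Proof.
have B0 : 0 <= bump_const k :> R by rewrite mulr_ge0// addr_ge0.
have /andP[r0 r1] := rho01.
have le (x : 'rV[R]_n) (z : R) : `|z| <= bump_const k * rho * pospow k.+1 (parab rho x) ->
    `|z| <= bump_const k + 1.
  move=> zle; apply: (le_trans zle); apply: (@le_trans _ _ (bump_const k)); last by rewrite lerDl.
  rewrite -mulrA ler_piMr// mulr_ile1// ?pospow_ge0//.
  by rewrite pospow_le1//; exact: parab_le1.
move=> x; split=> [|i|i j].
- rewrite ger0_norm ?bump_ge0// (le_trans (bump_le1 _))// lerDr//.
- by rewrite partial_bump; apply: (le x); apply: dbump_le; exact: rho01.
- by rewrite partial_bump partial_dbump; apply: (le x); apply: ddbump_le; exact: rho01.
Qed.

Lemma test_function_cutoff : test_function +oo%E cutoff.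
Proof.
apply: (test_function_separable N.+1%:R (bump_const k + 1) _ dramp _ cube).
- exact: ramp_eq0.
- exact: is_derive_ramp.
- exact: continuous_dramp.
- exact: compact_cube.
- move=> x; have [x0|/parab_gt0_cube//] := leP (parab rho x) 0.
  by rewrite /ball_bump /pospow max_l// expr0n eqxx.
- exact: Ck2_bump.
- exact: C2_bounded_bump.
Qed.

Lemma cutoff_ge0 t x : 0 <= cutoff t x.
Proof. by rewrite mulr_ge0 ?pospow_ge0. Qed.

Lemma derive1_cutoff t x : derive1 (cutoff ^~ x) t = dramp t * ball_bump rho k x.
Proof.
rewrite derive1E (_ : cutoff ^~ x = ball_bump rho k x *: ramp); last first.
  by apply/funext => s; rewrite /cutoff mulrC.
by have dr := is_derive_ramp t; rewrite derive_val [_ *: _]mulrC.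
Qed.

End cutoff.

(** * The a priori estimate *)

Section young.
Context {R : realType}.
Implicit Types (p w c y : R).

(** Young's inequality without its sharp constants, by comparing [c] with [w]^ (p -
    1)[: if]c[is smaller, the product is at most]w [^ p]; otherwise [w] is at most [c]^ (p -
    1)^-1[and the product is at most]c [^ (p / (p - 1))]. *)
Lemma mulr_le_powRD p w c : 1 < p -> 0 <= w -> 0 <= c ->
  w * c <= w `^ p + c `^ (p / (p - 1)).
Proof.
move=> p1 w0 c0; have p10 : 0 < p - 1 by rewrite subr_gt0.
have [cw|wc] := leP c (w `^ (p - 1)).
  rewrite (@le_trans _ _ (w `^ p)) ?lerDl ?powR_ge0//.
  by rewrite -(@mulr_powRB1 _ w p) ?ler_wpM2l// (lt_trans _ p1).
have cgt0 : 0 < c by rewrite (le_lt_trans _ wc)// powR_ge0.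
have wle : w <= c `^ (p - 1)^-1.
  have := ge0_ler_powR (ltW (_ : 0 < (p - 1)^-1)).
  move=> /(_ _ (w `^ (p - 1)) c); rewrite !nnegrE powR_ge0 c0 -powRrM mulfV ?gt_eqF//.
  by rewrite powRr1//; apply => //; [rewrite invr_gt0|exact: ltW].
rewrite (@le_trans _ _ (c `^ (p / (p - 1)))) ?lerDr ?powR_ge0//.
rewrite (_ : p / (p - 1) = (p - 1)^-1 + 1); last by field; rewrite gt_eqF.
by rewrite powRD ?(gt_eqF cgt0) ?implybT// powRr1// ler_wpM2r.
Qed.

(** For a base in [[0, 1]] a larger exponent gives a smaller power, and [k.+1 * p] is at least
    [k.+3]. This turns the power left by two derivatives back into the full cutoff. *)
Lemma powR_mul_expr_le p w y (k : nat) :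
  0 <= w -> 0 <= y <= 1 -> k.+3%:R <= k.+1%:R * p ->
  (w * y ^+ k.+1) `^ p <= w `^ p * y ^+ k.+3.
Proof.
move=> w0 /andP[y0 y1] kp.
rewrite powRM ?exprn_ge0// ler_wpM2l ?powR_ge0//.
(* The comparison of real powers wants a positive base, so [y = 0] is treated apart. *)
have [->|yn0] := eqVneq y 0.
  rewrite !expr0n/= powR0// gt_eqF// -(@pmulr_rgt0 _ k.+1%:R)//.
  by rewrite (lt_le_trans _ kp).
by rewrite -!powR_mulrn// -powRrM ger_powR// lt0r yn0 y0 y1.
Qed.

End young.

(** * Pointwise bound on the derivatives of the cutoff *)

Section cutoff_bound.
Context {R : realType} {n m : nat}.
Variables (a : 'I_m -> 'I_n -> 'rV[R]_n -> R) (A : R) (k N : nat).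
Hypothesis A0 : 0 <= A.
Hypothesis sa : forall i j, smooth (a i j).
Hypothesis aA : forall i j x, `|a i j x| <= A.
Hypothesis paA : forall i j l x, `|partial j (a i l) x| <= A.

Let rho : R := N.+1%:R^-1.

(** The common base: the cutoff is its power [k.+3]. *)
Definition profile (t : R) (x : 'rV[R]_n) : R :=
  Num.max 0 (1 - rho * t) * Num.max 0 (parab rho x).

(** The first summand is for the time derivative, the second for the spatial operator. *)
Definition operator_const : R :=
  k.+3%:R + m%:R * (3 * n%:R ^+ 2 * A ^+ 2) * bump_const k.

Let laplacian_const_ge0 :
  0 <= m%:R * (3 * n%:R ^+ 2 * A ^+ 2) * bump_const k :> R.
Proof.
rewrite mulr_ge0//; last by rewrite mulr_ge0// addr_ge0.
by rewrite mulr_ge0// mulr_ge0 ?sqr_ge0// mulr_ge0// exprn_ge0.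
Qed.

Lemma operator_const_ge0 : 0 <= operator_const.
Proof. by rewrite addr_ge0. Qed.

Lemma profile01 t x : 0 <= t -> 0 <= profile t x <= 1.
Proof.
move=> t0; rewrite mulr_ge0 ?pos_ge0//= mulr_ile1 ?pos_ge0// ge_max ler01/=.
  by rewrite gerBl mulr_ge0// invr_ge0.
exact: parab_le1.
Qed.

Lemma cutoffE t x : cutoff k N t x = profile t x ^+ k.+3.
Proof. by rewrite /profile exprMn. Qed.

Lemma vf_laplacian_cutoff t x :
  vf_laplacian a (cutoff k N t) x = ramp k N t * vf_laplacian a (ball_bump rho k) x.
Proof. by rewrite /cutoff vf_laplacian_scale//; exact: Ck2_bump. Qed.

(** The time derivative leaves the exponents [k.+2] in time and [k.+3] in space; the spatial
    operator leaves [k.+3] and [k.+1]. For [t >= 0] both bases are at most [1], so all exponents may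
    be lowered to [k.+1]. *)
Lemma cutoff_operator_le t x : 0 <= t ->
  `|dramp k N t * ball_bump rho k x| + `|ramp k N t * vf_laplacian a (ball_bump rho k) x|
   <= operator_const * rho * profile t x ^+ k.+1.
Proof.
move=> t0; have /andP[rho0 rho1] : 0 <= rho <= 1 := rho01 N.
have a1 : 1 - rho * t <= 1 by rewrite gerBl mulr_ge0.
have z1 := parab_le1 rho x.
have powM l : pospow l (1 - rho * t) * pospow l (parab rho x) = profile t x ^+ l.
  by rewrite /profile exprMn.
rewrite /operator_const 2!mulrDl; apply: lerD; rewrite normrM.
  rewrite normrN normrM [`|k.+3%:R / _|]ger0_norm ?mulr_ge0//.
  rewrite !(ger0_norm (pospow_ge0 _ _)).
  rewrite -[leLHS]mulrA ler_wpM2l ?mulr_ge0// -powM.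
  apply: ler_pM; [exact: pospow_ge0|exact: pospow_ge0|exact: pospow_le|].
  by apply: pospow_le => //; exact: leqW.
have Dx : 0 <= bump_const k * rho * pospow k.+1 (parab rho x).
  by rewrite mulr_ge0 ?pospow_ge0// mulr_ge0// mulr_ge0// addr_ge0.
have := vf_laplacian_le a sa _ _ _ x A0 Dx (fun i j => aA i j x)
  (fun i j l => paA i j l x) (Ck2_bump rho k).
move=> /(_ (fun i => _)) lap.
rewrite (ger0_norm (pospow_ge0 _ _)).
apply: (@le_trans _ _ (pospow k.+3 (1 - rho * t) * (m%:R * (3 * n%:R ^+ 2 * A ^+ 2) *
    (bump_const k * rho * pospow k.+1 (parab rho x))))).
  rewrite ler_wpM2l ?pospow_ge0// lap//.
  - by move=> i; rewrite partial_bump; apply: dbump_le; exact: rho01.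
  - by move=> i j; rewrite partial_bump partial_dbump; apply: ddbump_le; exact: rho01.
rewrite -powM.
have le := pospow_le _ _ _ (leqW (leqnSn k.+1)) a1.
rewrite [leLHS](_ : _ = m%:R * (3 * n%:R ^+ 2 * A ^+ 2) * bump_const k * rho *
   (pospow k.+3 (1 - rho * t) * pospow k.+1 (parab rho x))); last ring.
rewrite ler_wpM2l//.
  by rewrite mulr_ge0.
by rewrite ler_wpM2r// pospow_ge0.
Qed.

End cutoff_bound.

(** * Upper bound for the forcing integral of a weak solution *)

Section weak_solution_estimate.
Context {R : realType} {n : nat}.
Implicit Types (g : measurableTypeR R * 'rV[R]_n -> R).

Local Notation QT := (@cylinder R n +oo%E).
Local Notation mu := (@spacetime_measure R n).

Lemma open_timeyE : @open_time R +oo%E = [set` `]0, +oo[%R].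
Proof.
apply/seteqP; split=> t; rewrite /open_time /= in_itv/= andbT; first by case.
by move=> ->; rewrite ltry.
Qed.

Lemma measurable_cylindery : measurable QT.
Proof. by apply: measurableX => //; rewrite open_timeyE. Qed.

Lemma measurable_tensor (D : set (measurableTypeR R * 'rV[R]_n)) (F : R -> R) (G : 'rV[R]_n -> R) :
  continuous F -> measurable_fun setT (G : _ -> measurableTypeR R) ->
  measurable_fun D (fun z : measurableTypeR R * 'rV[R]_n => F z.1 * G z.2).
Proof.
move=> cF mG; apply: measurable_funTS; apply: measurable_funM.
  exact: measurableT_comp (continuous_measurable_fun cF) measurable_fst.
exact: measurableT_comp mG measurable_snd.
Qed.

(** Infinite summands cannot cancel in [\bar R], so a finite sum has finite terms. *)
Lemma fin_num_sum5 (x1 x2 x3 x4 x5 : \bar R) : (x1 + x2 + x3 + x4 + x5 = 0)%E ->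
  [/\ x1 \is a fin_num, x2 \is a fin_num, x3 \is a fin_num,
      x4 \is a fin_num & x5 \is a fin_num].
Proof.
move=> x0; have : (x1 + x2 + x3 + x4 + x5)%E \is a fin_num by rewrite x0.
by rewrite !fin_numD => /andP[/andP[/andP[/andP[]]]].
Qed.

(** The integral is the difference of those of the positive and negative parts, and is finite only
    if both are. *)
Lemma fin_num_integrable d (T : measurableType d) (nu : {measure set T -> \bar R})
    (D : set T) (h : T -> R) : measurable D -> measurable_fun D h ->
  (\int[nu]_(x in D) (h x)%:E)%E \is a fin_num -> nu.-integrable D (EFin \o h).
Proof.
move=> mD mh fh; apply/integrableP; split; first exact/measurable_EFinP.
by rewrite integral_fin_num_abs.
Qed.

Lemma ae_ge0_integral_ge0 d (T : measurableType d) (nu : {measure set T -> \bar R})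
    (h : T -> R) : measurable_fun setT h -> {ae nu, forall x, 0 <= h x} ->
  (0 <= \int[nu]_x (h x)%:E)%E.
Proof.
move=> mh h0; rewrite (ae_eq_integral (fun x => `|h x|%:E))//.
- by apply: integral_ge0 => x _; rewrite lee_fin.
- exact/measurable_EFinP.
- by apply/measurable_EFinP; exact: measurableT_comp.
- by apply: filterS h0 => x hx _; rewrite ger0_norm.
Qed.

Lemma measurable_cube N : measurable (cube N : set 'rV[R]_n).
Proof.
have -> : cube N = \bigcap_(i in [set: 'I_n])
    (fun x : 'rV[R]_n => x ord0 i) @^-1` [set` `[- N.+1%:R, N.+1%:R]%R].
  by apply/seteqP; split => [x Nx i _|x Nx i]; exact: Nx.
apply: fin_bigcap_measurable => [|i _]; first exact: finite_finset.
rewrite -[X in measurable X]setTI; exact: measurable_rV_coord.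
Qed.

Lemma lebesgue_rV_cube N :
  lebesgue_rV n (cube N : set 'rV[R]_n) = ((2 * N.+1%:R) ^+ n)%:E.
Proof.
have -> := @lebesgue_rV_box R n (fun=> [set` `[- (N.+1%:R : R), N.+1%:R]%R]); last first.
  by move=> i; exact: measurable_itv.
rewrite (eq_bigr (fun=> (2 * N.+1%:R)%:E)) => [|i _].
  by rewrite prodEFin prodr_const card_ord.
rewrite lebesgue_measure_itv/= lte_fin gtrN ?ltr0n// -EFinB; congr (_%:E).
by ring.
Qed.

Definition spacetime_box N : set (measurableTypeR R * 'rV[R]_n) :=
  [set` `[0, N.+1%:R]%R] `*` cube N.

Lemma measurable_spacetime_box N : measurable (spacetime_box N).
Proof. by apply: measurableX; [exact: measurable_itv|exact: measurable_cube]. Qed.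

Lemma spacetime_measure_box N :
  mu (spacetime_box N) = (N.+1%:R * (2 * N.+1%:R) ^+ n)%:E.
Proof.
rewrite [LHS]product_measure1E//; last exact: measurable_cube.
rewrite EFinM; congr (_ * _)%E; last exact: lebesgue_rV_cube.
by rewrite [LHS]lebesgue_measure_itv/= lte_fin ltr0n/= oppr0 addr0.
Qed.

Lemma profile_eq0 N (z : measurableTypeR R * 'rV[R]_n) :
  0 < z.1 -> ~ spacetime_box N z -> profile N z.1 z.2 = 0.
Proof.
move=> z0 zS; have [tN|tN] := leP z.1 N.+1%:R; last first.
  rewrite /profile max_l ?mul0r// subr_le0 mulrC.
  by rewrite ler_pdivlMr ?mul1r ?ltW ?ltr0n.
rewrite /profile [X in _ * X]max_l ?mulr0// leNgt; apply/negP => /parab_gt0_cube zc.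
by apply: zS; split => //=; rewrite in_itv/= tN ltW.
Qed.

Section estimate.
Context {m : nat}.
Variables (a : 'I_m -> 'I_n -> 'rV[R]_n -> R) (p A : R) (k N : nat).
Variables (f u0 : 'rV[R]_n -> R) (u : R -> 'rV[R]_n -> R).
Hypothesis A0 : 0 <= A.
Hypothesis sa : forall i j, smooth (a i j).
Hypothesis aA : forall i j x, `|a i j x| <= A.
Hypothesis paA : forall i j l x, `|partial j (a i l) x| <= A.
Hypothesis p1 : 1 < p.
Hypothesis kp : k.+3%:R <= k.+1%:R * p.
Hypothesis mu0 : measurable_fun setT (u0 : _ -> measurableTypeR R).
Hypothesis u0_ge0 : {ae lebesgue_rV n, forall x, 0 <= u0 x}.
Hypothesis weak : weak_solution a p f u0 +oo%E u.

Let rho : R := N.+1%:R^-1.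
Let C : R := @operator_const R n m A k.
Let c : R := (C * rho) `^ (p / (p - 1)).

(** [g1], [g4] and [g5] are the first, fourth and fifth integrands of the weak equation tested
    against the cutoff. [g6] is the constant term of Young's inequality, spread over a box that
    contains the support. *)
Let g1 (z : measurableTypeR R * 'rV[R]_n) : R :=
  `|u z.1 z.2| `^ p * cutoff k N z.1 z.2.
Let g4 (z : measurableTypeR R * 'rV[R]_n) : R :=
  u z.1 z.2 * (dramp k N z.1 * ball_bump rho k z.2).
Let g5 (z : measurableTypeR R * 'rV[R]_n) : R :=
  u z.1 z.2 * (ramp k N z.1 * vf_laplacian a (ball_bump rho k) z.2).
Let g6 (z : measurableTypeR R * 'rV[R]_n) : R := c * \1_(spacetime_box N) z.

Let c_ge0 : 0 <= c. Proof. exact: powR_ge0. Qed.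

(** On the box, Young's inequality with [w = |u| y^(k+1)] and the constant factor [C * rho] bounds
    [- (g4 + g5)] by [g1 + g6]. Off the box the profile [y] vanishes. *)
Let integrand_ge0 z : QT z -> 0 <= g1 z + (g4 z + g5 z) + g6 z.
Proof.
move=> [[/= z0 _] _].
have /andP[y0 y1] := profile01 N z.1 z.2 (ltW z0).
have g45 : - (g4 z + g5 z) <=
    `|u z.1 z.2| * (C * rho * profile N z.1 z.2 ^+ k.+1).
  apply: (le_trans (ler_norm _)).
  rewrite normrN /g4 /g5 -mulrDr normrM ler_wpM2l//.
  apply: (le_trans (ler_normD _ _)).
  exact: (cutoff_operator_le _ _ _ _ A0 sa aA paA _ _ (ltW z0)).
suff : `|u z.1 z.2| * (C * rho * profile N z.1 z.2 ^+ k.+1) <= g1 z + g6 z.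
  by lra.
have g1_ge0 : 0 <= g1 z by rewrite mulr_ge0 ?powR_ge0 ?cutoff_ge0.
have [zS|zS] := pselect (spacetime_box N z); last first.
  rewrite profile_eq0// expr0n !mulr0 addr_ge0// mulr_ge0//.
rewrite /g6 indicE mem_set// mulr1 [C * rho * _]mulrC mulrA.
rewrite (@le_trans _ _ ((`|u z.1 z.2| * profile N z.1 z.2 ^+ k.+1) `^ p + c))//.
  apply: mulr_le_powRD => //.
    by rewrite mulr_ge0// exprn_ge0.
  by rewrite mulr_ge0// ?invr_ge0//; exact: operator_const_ge0.
rewrite lerD2r /g1 cutoffE; apply: powR_mul_expr_le => //.
exact/andP.
Qed.

(** Integrating the pointwise inequality gives [I1 + I4 + I5 + I6 >= 0], with [I6] the integral of
    [g6]. The weak equation equates [I1 + I4 + I5] with [- I2 - I], and [I2 >= 0] by the sign of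
    [u0]; hence [I <= I6]. *)
Lemma weak_solution_cutoff_le :
  let I := (\int[mu]_(z in QT) (f z.2 * cutoff k N z.1 z.2)%:E)%E in
  I \is a fin_num /\ (I <= (c * (N.+1%:R * (2 * N.+1%:R) ^+ n))%:E)%E.
Proof.
move=> I.
have [[mu_ _] /(_ _ (test_function_cutoff k N))] := weak.
move=> /(_ (fun t x _ => cutoff_ge0 k N t x)).
set I1 := integral _ _ _; set I2 := integral _ _ _; rewrite -/I.
set I4 := integral _ _ _; set I5 := integral _ _ _ => sum0.
have I4E : I4 = (\int[mu]_(z in QT) (g4 z)%:E)%E.
  by apply: eq_integral => z _; rewrite derive1_cutoff.
have I5E : I5 = (\int[mu]_(z in QT) (g5 z)%:E)%E.
  by apply: eq_integral => z _; rewrite vf_laplacian_cutoff.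
(* Finiteness of each term gives the integrability that additivity of the integral requires. *)
have [f1 f2 f3 f4 f5] := fin_num_sum5 _ _ _ _ _ sum0.
split => //.
have mQ := measurable_cylindery.
have cbump : continuous (ball_bump rho k : 'rV[R]_n -> R).
  exact: continuous_bump.
have mbump : measurable_fun setT (ball_bump rho k : 'rV[R]_n -> measurableTypeR R).
  exact: continuous_measurable_rV.
have mlap : measurable_fun setT
    (vf_laplacian a (ball_bump rho k) : 'rV[R]_n -> measurableTypeR R).
  by apply: continuous_measurable_rV; apply: continuous_vf_laplacian => //; exact: Ck2_bump.
have i1 : mu.-integrable QT (EFin \o g1).
  apply: fin_num_integrable => //; apply: measurable_funM.
    by apply: (measurableT_comp (measurable_powR p)); exact: measurableT_comp.
  by apply: measurable_tensor => //; exact: continuous_ramp_arg.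
have i4 : mu.-integrable QT (EFin \o g4).
  apply: fin_num_integrable => //; last by rewrite -I4E.
  by apply: measurable_funM => //; apply: measurable_tensor => //; exact: continuous_dramp.
have i5 : mu.-integrable QT (EFin \o g5).
  apply: fin_num_integrable => //; last by rewrite -I5E.
  by apply: measurable_funM => //; apply: measurable_tensor => //; exact: continuous_ramp_arg.
have I6E : (\int[mu]_(z in QT) (g6 z)%:E = c%:E * mu (spacetime_box N `&` QT))%E.
  rewrite -integral_indic//; last exact: measurable_spacetime_box.
  rewrite -ge0_integralZl_EFin//.
  by apply/measurable_EFinP; apply: measurable_funTS; apply: measurable_indic; exact: measurable_spacetime_box.
(* Only an inequality is claimed: the box contains the slice [t = 0], which the cylinder omits. *)
have I6le : (\int[mu]_(z in QT) (g6 z)%:E <= (c * (N.+1%:R * (2 * N.+1%:R) ^+ n))%:E)%E.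
  rewrite I6E EFinM -spacetime_measure_box lee_wpmul2l ?lee_fin//.
  apply: le_measure; rewrite ?inE//; [|exact: measurable_spacetime_box].
  by apply: measurableI => //; exact: measurable_spacetime_box.
have f6 : (\int[mu]_(z in QT) (g6 z)%:E)%E \is a fin_num.
  rewrite ge0_fin_numE ?(le_lt_trans I6le) ?ltry// I6E mule_ge0//.
have i6 : mu.-integrable QT (EFin \o g6).
  apply: fin_num_integrable => //; apply: measurable_funM => //.
  by apply: measurable_funTS; apply: measurable_indic; exact: measurable_spacetime_box.
have : (0 <= \int[mu]_(z in QT) (g1 z + (g4 z + g5 z) + g6 z)%:E)%E.
  by apply: integral_ge0 => z Qz; rewrite lee_fin; exact: integrand_ge0.
have i45 := integrableD mQ i4 i5.
have i145 := integrableD mQ i1 i45.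
rewrite (integralD_EFin mQ i145 i6) (integralD_EFin mQ i1 i45) (integralD_EFin mQ i4 i5).
rewrite -I4E -I5E => le0.
have I20 : (0 <= I2)%E.
  apply: ae_ge0_integral_ge0.
    apply: measurable_funM => //.
    by apply: measurable_funM => //; exact: measurable_cst.
  apply: filterS u0_ge0 => x u0x; rewrite mulr_ge0//; exact: cutoff_ge0.
apply: le_trans _ I6le; move: le0 sum0 I20.
rewrite -[integral _ _ (EFin \o g1)]/I1 -[integral _ _ (EFin \o g6)]/(\int[mu]_(z in QT) (g6 z)%:E)%E.
rewrite -(fineK f1) -(fineK f2) -(fineK f3) -(fineK f4) -(fineK f5) -(fineK f6).
rewrite -!EFinD !lee_fin => le0 [sum0] I20; lra.
Qed.

End estimate.
End weak_solution_estimate.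

(** * Lower bound for the forcing term *)

Section forcing_lower_bound.
Context {R : realType} {n : nat}.
Variables (k : nat) (f : 'rV[R]_n -> R).
Hypothesis fL1 : L1_loc f.

Local Notation bumpN N := (ball_bump (N.+1%:R^-1) k : 'rV[R]_n -> R).
Local Notation nu := (lebesgue_rV n).

Let mf : measurable_fun setT (f : _ -> measurableTypeR R) := fL1.1.

Lemma measurable_ball_bump (rho : R) :
  measurable_fun setT (ball_bump rho k : 'rV[R]_n -> measurableTypeR R).
Proof. apply: continuous_measurable_rV; exact: continuous_bump. Qed.

(** Local integrability of [f] is enough: the product is dominated by [f] cut off to the compact
    cube. *)
Lemma integrable_mul_bump N : nu.-integrable setT (EFin \o (fun x => f x * bumpN N x)).
Proof.
have mfb : measurable_fun setT (EFin \o (fun x => f x * bumpN N x)).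
  by apply/measurable_EFinP; apply: measurable_funM => //; exact: measurable_ball_bump.
have icube : nu.-integrable (cube N) (EFin \o f).
  apply/integrableP; split.
    by apply/measurable_EFinP; exact: measurable_funTS.
  by apply: fL1.2; exact: compact_cube.
move/(integrable_mkcond _ (measurable_cube N)) : icube; apply: le_integrable => // x _.
rewrite /patch; case: ifPn => [xN|]; last first.
  rewrite notin_setE => xN; rewrite /= /ball_bump /pospow.
  rewrite max_l ?expr0n ?mulr0//= leNgt; apply/negP => /parab_gt0_cube.
  exact: xN.
rewrite lee_fin normrM ler_piMr// ger0_norm ?bump_ge0//.
exact: bump_le1.
Qed.

(** At a fixed [x] the bump is a continuous function of [rho] with value [1] at [rho = 0], evaluated
    along the harmonic sequence. *)
Lemma cvg_bump x : bumpN N x @[N --> \oo] --> (1 : R).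
Proof.
have at0 : pospow k.+3 (1 - 0 ^+ 2 * \sum_i x ord0 i ^+ 2) = 1.
  by rewrite expr0n/= mul0r subr0 /pospow max_r ?ler01// expr1n.
have cg : continuous (fun r : R => pospow k.+3 (1 - r ^+ 2 * \sum_i x ord0 i ^+ 2)).
  move=> r; apply: (@continuous_comp _ _ _
    (fun r : R => 1 - r ^+ 2 * \sum_i x ord0 i ^+ 2) (pospow k.+3)).
    apply: continuous_sub; first exact: continuous_const.
    by apply: continuous_mul; [exact: exprn_continuous|exact: continuous_const].
  exact: continuous_pospow.
have := cg 0; rewrite /continuous_at at0 => cg0.
exact: (@cvg_comp _ _ _ (@harmonic R) _ _ _ _ cvg_harmonic cg0).
Qed.

Lemma le_bump (N M : nat) x : (N <= M)%N -> bumpN N x <= bumpN M x.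
Proof.
move=> NM; apply: le_pospow; rewrite lerD2l lerN2 ler_wpM2r//.
  by apply: sumr_ge0 => i _; exact: sqr_ge0.
by rewrite lerXn2r ?nnegrE ?invr_ge0// lef_pV2 ?posrE ?ltr0n// ler_nat.
Qed.

Hypothesis f_gt0 : (0 < \int[nu]_x (f x)%:E)%E.

(** The integral of [f] may be [+oo], so dominated convergence is replaced by monotone convergence
    on the positive part, while the negative part is bounded by its full integral. *)
Lemma forcing_lower_bound : exists c (N0 : nat), 0 < c /\
  forall N, (N0 <= N)%N -> (c%:E <= \int[nu]_x (f x * bumpN N x)%:E)%E.
Proof.
pose fp x := Num.max (f x) 0; pose fn x := Num.max (- f x) 0.
have fp0 x : 0 <= fp x by rewrite le_max lexx orbT.
have fn0 x : 0 <= fn x by rewrite le_max lexx orbT.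
have mfp : measurable_fun setT fp by exact: measurable_maxr.
have mfn : measurable_fun setT fn.
  by apply: measurable_maxr => //; exact: measurableT_comp.
have mfpb N : measurable_fun setT (fun x => (fp x * bumpN N x)%:E).
  by apply/measurable_EFinP; apply: measurable_funM => //; exact: measurable_ball_bump.
have mfnb N : measurable_fun setT (fun x => (fn x * bumpN N x)%:E).
  by apply/measurable_EFinP; apply: measurable_funM => //; exact: measurable_ball_bump.
have posE (g b : 'rV[R]_n -> R) : (forall x, 0 <= b x) ->
    (\int[nu]_x (g x * b x)%:E = \int[nu]_x (Num.max (g x) 0 * b x)%:E
      - \int[nu]_x (Num.max (- g x) 0 * b x)%:E)%E.
  move=> b0; rewrite integralE; congr (_ - _)%E; apply: eq_integral => x _.
    by rewrite funeposE -EFin_max maxr_pMl ?mul0r.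
  by rewrite funenegE -EFinN -EFin_max maxr_pMl ?mul0r ?mulNr.
(* The integral of [f] is the difference of those of [fp] and [fn]; as [+oo - +oo] is [-oo] in
   [\bar R], its positivity makes the second strictly smaller, hence finite. *)
have nlt : (\int[nu]_x (fn x)%:E < \int[nu]_x (fp x)%:E)%E.
  move: f_gt0; have := posE f (fun=> 1) (fun=> ler01).
  under eq_integral do rewrite mulr1.
  move=> ->; rewrite sube_gt0.
  under eq_integral do rewrite mulr1.
  by under [X in (_ < X)%E -> _]eq_integral do rewrite mulr1.
have cvgP : (\int[nu]_x (fp x * bumpN N x)%:E)%E @[N --> \oo] --> (\int[nu]_x (fp x)%:E)%E.
  have -> : (\int[nu]_x (fp x)%:E)%E =
      (\int[nu]_x (fun x => limn (fun N => (fp x * bumpN N x)%:E)) x)%E.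
    apply: eq_integral => x _; apply/esym/cvg_lim => //.
    apply/cvg_EFin; first by near=> N.
    rewrite -[X in _ --> X]mulr1; apply: cvgMr; exact: cvg_bump.
  apply: cvg_monotone_convergence => //.
    by move=> N x _; rewrite lee_fin mulr_ge0// bump_ge0.
  by move=> x _ N M NM; rewrite lee_fin ler_wpM2l// le_bump.
have [N0 N0lt] : exists N0, (\int[nu]_x (fn x)%:E < \int[nu]_x (fp x * bumpN N0 x)%:E)%E.
  have : \forall y \near (\int[nu]_x (fp x)%:E)%E, (\int[nu]_x (fn x)%:E < y)%E.
    exact: open_ereal_gt'.
  by move/cvgP => [N0 _ HN]; exists N0; apply: HN => /=.
pose P N := (\int[nu]_x (fp x * bumpN N x)%:E)%E.
have fnfin : (\int[nu]_x (fn x)%:E)%E \is a fin_num.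
  rewrite ge0_fin_numE; first by rewrite (lt_le_trans nlt)// leey.
  by apply: integral_ge0 => x _; rewrite lee_fin.
have Pfin : P N0 \is a fin_num.
  rewrite ge0_fin_numE; last first.
    by apply: integral_ge0 => x _; rewrite lee_fin mulr_ge0// bump_ge0.
  have /integrableP[mfb] := integrable_mul_bump N0.
  apply: le_lt_trans; apply: ge0_le_integral => //.
  - by move=> x _; rewrite lee_fin mulr_ge0// bump_ge0.
  - exact: measurableT_comp.
  - move=> x _; rewrite lee_fin normrM (ger0_norm (bump_ge0 _ _ _)).
    apply: ler_wpM2r; first exact: bump_ge0.
    by rewrite ge_max ler_norm normr_ge0.
(* The gap reached at [N0] persists: for larger [N] the positive part only grows, and the negative
   part never exceeds its full integral. *)
exists (fine (P N0) - fine (\int[nu]_x (fn x)%:E)%E), N0; split.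
  by rewrite subr_gt0 fine_lt.
have JE N : (\int[nu]_x (f x * bumpN N x)%:E = P N - \int[nu]_x (fn x * bumpN N x)%:E)%E.
  by apply: posE => x; exact: bump_ge0.
move=> N N0N; rewrite JE EFinB !fineK//; apply: leeB.
  apply: ge0_le_integral => //.
  - by move=> x _; rewrite lee_fin mulr_ge0// bump_ge0.
  - by move=> x _; rewrite lee_fin ler_wpM2l// le_bump.
apply: ge0_le_integral => //.
- by move=> x _; rewrite lee_fin mulr_ge0// bump_ge0.
- exact/measurable_EFinP.
- by move=> x _; rewrite lee_fin ler_piMr// bump_le1.
Unshelve. all: by end_near. Qed.

End forcing_lower_bound.

(** * Linear growth of the space-time forcing integral *)

Section spacetime_lower_bound.
Context {R : realType} {n : nat}.
Variables (k N : nat) (f : 'rV[R]_n -> R).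
Hypothesis fL1 : L1_loc f.

Local Notation QT := (@cylinder R n +oo%E).
Local Notation J := (\int[lebesgue_rV n]_x (f x * ball_bump (N.+1%:R^-1) k x)%:E)%E.
Local Notation I := (\int[@spacetime_measure R n]_(z in QT) (f z.2 * cutoff k N z.1 z.2)%:E)%E.

(* The ramp is at least [2^-(k+3)] on the first half of its support. *)
Lemma spacetime_integral_ge (c : R) :
  I \is a fin_num -> 0 <= c -> (c%:E <= J)%E ->
  ((2^-1 ^+ k.+3 * c * (N.+1%:R / 2))%:E <= I)%E.
Proof.
move=> Ifin c0 cJ.
have mQ := @measurable_cylindery R n.
pose F (z : measurableTypeR R * 'rV[R]_n) : R := f z.2 * cutoff k N z.1 z.2.
have mF : measurable_fun QT F.
  apply: measurable_funM.
    by apply: measurable_funTS; exact: (measurableT_comp fL1.1 measurable_snd).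
  by apply: measurable_tensor; [exact: continuous_ramp_arg|exact: measurable_ball_bump].
have iF := fin_num_integrable _ _ _ _ _ mQ mF Ifin.
move/(integrable_mkcond _ mQ) : iF => iF.
(* Extension by zero off the cylinder allows Fubini on the whole product. Each slice at [t > 0] is
   then the ramp times the spatial integral [J], hence nonnegative although [f] may change sign. *)
have slice (t : measurableTypeR R) :
    fubini_F (lebesgue_rV n) ((EFin \o F) \_ QT) t =
    if 0 < t then ((ramp k N t)%:E * J)%E else 0%E.
  rewrite /fubini_F; case: ifPn => t0; last first.
    apply: integral0_eq => x _; rewrite patchE memNset//.
    by case=> -[/= t0' _] _; move/negP: t0; exact.
  rewrite -integralZl//; last exact: integrable_mul_bump.
  apply: eq_integral => x _; rewrite patchE mem_set/=; last first.
    by split => //; split => //=; exact: ltry.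
  by rewrite /F/= /cutoff -EFinM; congr (_%:E); ring.
have J0 : (0 <= J)%E by apply: le_trans cJ; rewrite lee_fin.
have -> : I = (\int[lebesgue_measure]_t fubini_F (lebesgue_rV n) ((EFin \o F) \_ QT) t)%E.
  by rewrite integral12_prod_meas1// -integral_mkcond.
have mslice := measurable_fubini_F iF.
have slice_ge0 t : (0 <= fubini_F (lebesgue_rV n) ((EFin \o F) \_ QT) t)%E.
  by rewrite slice; case: ifPn => // _; rewrite mule_ge0// lee_fin pospow_ge0.
(* For [t] in [H] the base [1 - rho * t] of the ramp is at least [1/2]. *)
pose H : set (measurableTypeR R) := [set` `]0, (N.+1%:R / 2)]%R].
have mH : measurable H by exact: measurable_itv.
apply: (@le_trans _ _ (\int[lebesgue_measure]_(t in H) fubini_F (lebesgue_rV n) ((EFin \o F) \_ QT) t)%E); last first.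
  by apply: ge0_subset_integral.
apply: (@le_trans _ _ (\int[lebesgue_measure]_(t in H) cst (2^-1 ^+ k.+3 * c)%:E t)%E).
  rewrite integral_cst// [X in (_ <= _ * X)%E]lebesgue_measure_itv/= lte_fin divr_gt0//.
  by rewrite -EFinB subr0 -EFinM.
apply: ge0_le_integral => //.
- by move=> t _; rewrite lee_fin mulr_ge0// exprn_ge0// invr_ge0.
- exact: measurable_funTS.
- move=> t; rewrite /H/= in_itv/= => /andP[t0 tN]; rewrite slice t0 EFinM.
  apply: lee_pmul => //; rewrite ?lee_fin ?exprn_ge0 ?invr_ge0//.
  rewrite /ramp /pospow lerXn2r ?nnegrE ?invr_ge0 ?pos_ge0// le_max.
  apply/orP; right; rewrite lerBrDr -lerBrDl.
  rewrite mulrC ler_pdivrMr ?ltr0n//.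
  by apply: (le_trans tN); rewrite mulrC ler_pM2r ?ltr0n//; lra.
Qed.

End spacetime_lower_bound.

(** * Uniform bounds and the final contradiction *)

Lemma no_eventual_powR_bound (R : realType) (q K : R) (N0 : nat) : 0 < q ->
  ~ (forall N, (N0 <= N)%N -> N.+1%:R `^ q <= K).
Proof.
move=> q0 h.
have K0 : 0 <= K by apply: le_trans (h _ (leqnn _)); exact: powR_ge0.
pose N := maxn N0 (Num.truncn ((K + 1) `^ q^-1)).
have := h N (leq_maxl _ _); rewrite leNgt => /negP; apply.
have : (K + 1) `^ q^-1 <= N.+1%:R.
  apply/ltW; apply: (lt_le_trans (truncnS_gt _)).
  by rewrite ler_nat ltnS leq_maxr.
move/(ge0_ler_powR (ltW q0)); rewrite !nnegrE powR_ge0 => /(_ isT (ler0n _ _)).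
rewrite -powRrM mulVf ?gt_eqF// powRr1 ?addr_ge0//.
by apply: lt_le_trans; rewrite ltrDl.
Qed.

Lemma bounded_fun_ub (R : realType) (T : Type) (g : T -> R) : bounded_fun g ->
  exists2 M, 0 <= M & forall x, `|g x| <= M.
Proof.
(* Only numbers strictly above [M] are known to be bounds, hence [M + 1]; the maximum with [0]
   covers an empty domain. *)
move=> [M [Mr gM]]; exists (Num.max 0 (M + 1)); first by rewrite le_max lexx.
by move=> x; apply: gM => //; rewrite lt_max ltrDl ltr01 orbT.
Qed.

Lemma bounded_funs_ub (R : realType) (T : Type) (I : finType) (g : I -> T -> R) :
  (forall i, bounded_fun (g i)) ->
  exists2 M, 0 <= M & forall i x, `|g i x| <= M.
Proof.
move=> bg; have /choice[M MP] i : exists M, 0 <= M /\ forall x, `|g i x| <= M.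
  by have [M M0 gM] := bounded_fun_ub _ _ _ (bg i); exists M.
exists (\sum_i M i); first by apply: sumr_ge0 => i _; have [] := MP i.
move=> i x; apply: (le_trans ((MP i).2 x)); rewrite (bigD1 i)//= lerDl.
by apply: sumr_ge0 => j _; have [] := MP j.
Qed.

Theorem theorem3p2 (R : realType) (n m : nat) (p : R)
    (f u0 : 'rV[R]_n -> R) (a : 'I_m -> 'I_n -> 'rV[R]_n -> R) :
  (2 < n)%N ->
  1 < p -> p < n%:R / (n%:R - 1) ->
  L1_loc f -> L1_loc u0 ->
  {ae lebesgue_rV n, forall x, 0 <= u0 x} ->
  (forall k i, smooth (a k i)) ->
  (0 < \int[lebesgue_rV n]_x (f x)%:E)%E ->
  (forall k i, bounded_fun (a k i)) ->
  (forall k i j, bounded_fun (partial i (a k j))) ->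
  ~ exists u : R -> 'rV[R]_n -> R, global_weak_solution a p f u0 u.
Proof.
move=> n2 p1 pn fL u0L u0_ge0 sa f_gt0 ba bpa [u weak].
have p10 : 0 < p - 1 by rewrite subr_gt0.
have [A1 A10 aA1] := bounded_funs_ub _ _ ('I_m * 'I_n)%type (fun i => a i.1 i.2)
  (fun i => ba i.1 i.2).
have [A2 A20 paA2] := bounded_funs_ub _ _ ('I_m * 'I_n * 'I_n)%type
  (fun i => partial i.1.2 (a i.1.1 i.2)) (fun i => bpa i.1.1 i.1.2 i.2).
have A0 : 0 <= A1 + A2 by rewrite addr_ge0.
have aA i j x : `|a i j x| <= A1 + A2.
  by apply: (le_trans (aA1 (i, j) x)); rewrite lerDl.
have paA i j l x : `|partial j (a i l) x| <= A1 + A2.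
  by apply: (le_trans (paA2 (i, j, l) x)); rewrite lerDr.
(* Chosen so that [k.+1 * (p - 1) >= 2], which is the exponent condition [k.+3 <= k.+1 * p]. *)
pose k := Num.truncn (2 / (p - 1)).
have kp : k.+3%:R <= k.+1%:R * p.
  have : 2 / (p - 1) <= k.+1%:R by apply/ltW; exact: truncnS_gt.
  by rewrite ler_pdivrMr// -[k.+3]addn2 natrD; lra.
have [c [N0 [c0 cJ]]] := forcing_lower_bound k f fL f_gt0.
pose q := p / (p - 1); pose C := @operator_const R n m (A1 + A2) k.
have C0 : 0 <= C by exact: operator_const_ge0.
(* Here the critical exponent enters: [p < n / (n - 1)] is equivalent to [n (p - 1) < p], that is
   [n < q]. *)
have nq : 0 < q - n%:R.
  rewrite subr_gt0 ltr_pdivlMr//.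
  have n1 : 0 < n%:R - 1 :> R by rewrite subr_gt0 ltr1n (ltn_trans _ n2).
  by move: pn; rewrite ltr_pdivlMr//; lra.
(* With [X = N + 1] and [d = 2^-(k+3) c / 2], the two estimates read [d X <= (C / X)^q X (2 X)^n].
   Solving for [X^(q - n)] gives the constant bound used here. *)
apply: (@no_eventual_powR_bound R (q - n%:R)
  (C `^ q * 2 ^+ n / (2^-1 ^+ k.+3 * c / 2)) N0 nq) => N N0N.
have [Ifin Ile] := weak_solution_cutoff_le _ _ _ k N _ _ _ A0 sa aA paA p1 kp u0L.1 u0_ge0 weak.
have := spacetime_integral_ge _ _ _ fL c Ifin (ltW c0) (cJ N N0N).
move=> /le_trans /(_ Ile); rewrite lee_fin -/C -/q.
have X0 : 0 < N.+1%:R :> R by rewrite ltr0n.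
move: (N.+1%:R) X0 => X X0 le.
have d0 : 0 < 2^-1 ^+ k.+3 * c / 2 by rewrite divr_gt0// mulr_gt0// exprn_gt0// invr_gt0.
rewrite ler_pdivlMr// powRB ?(gt_eqF X0) ?implybT// powR_mulrn ?(ltW X0)//.
have Xn0 : 0 < X ^+ n by rewrite exprn_gt0.
have Xq0 : 0 < X `^ q by rewrite powR_gt0.
have XVq : X^-1 `^ q = (X `^ q)^-1.
  by rewrite -(@powR_inv1 _ X) ?(ltW X0)// -powRrM mulN1r powRN.
move: le; rewrite powRM ?invr_ge0 ?(ltW X0)// XVq exprMn => le.
rewrite mulrAC ler_pdivrMr// -(ler_pM2r X0).
move: le; rewrite [leRHS](_ : _ = C `^ q * 2 ^+ n * X ^+ n * X / X `^ q); last ring.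
by rewrite ler_pdivlMr//; apply: le_trans; rewrite le_eqVlt; apply/orP; left; apply/eqP; ring.
Qed.
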